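(* Let $N\in\mathbb N$, $\delta=1/N$. Any positive solution $\rho$ to $$\dot\rho_\kappa=-2\,\Delta^\delta_\kappa\Big(\frac{\sqrt{\rho_+\rho_-}-\rho}{\delta^2}\Big)\qquad(\kappa\in[N])$$ satisfies $$-\frac{d}{dt}\mathcal H^\delta(\rho)=4\delta\sum_\kappa\left(\frac{\sqrt{\rho_{\kappa+1}\rho_{\kappa-1}}-\rho_\kappa}{\delta^2}\right)\left(\frac{\log\sqrt{\rho_{\kappa+1}\rho_{\kappa-1}}-\log\rho_\kappa}{\delta^2}\right)\ge\delta\sum_\kappa\big(\Delta^\delta_\kappa\sqrt\rho\big)^2.$$
   Context: $[N]=\mathbb Z/N\mathbb Z$ with cyclic indices. For $f:[N]\to\mathbb R$: $(f_\pm)_\kappa=f_{\kappa\pm1}$ and $\Delta^\delta f=(f_++f_--2f)/\delta^2$, with value $\Delta^\delta_\kappa f$ at $\kappa$; products and square roots are componentwise. A positive solution is one with values in $\mathcal P^\delta_{>0}=\{\rho:[N]\to\mathbb R:\rho_\kappa>0\ \forall\kappa,\ \delta\sum_\kappa\rho_\kappa=1\}$. Discrete entropy: $\mathcal H^\delta(\rho)=\delta\sum_\kappa\big(\rho_\kappa(\log\rho_\kappa-1)+1\big)$. *)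

(* Defs.v *)
From HB Require Import structures.
From mathcomp Require Import all_boot all_order all_algebra.
From mathcomp Require Import all_classical all_reals all_analysis.

Set Implicit Arguments.
Unset Strict Implicit.
Unset Printing Implicit Defensive.

Import Order.TTheory GRing.Theory Num.Theory.
Import numFieldNormedType.Exports.

Local Open Scope classical_set_scope.
Local Open Scope ring_scope.

(* Z/NZ is represented by
   ['I_N], with [ordS] and [ord_pred] as the cyclic maps k |-> k + 1 and
   k |-> k - 1; unlike ['Z_N], this is also right for N = 1. *)

Definition shiftp (R : realType) (N : nat) (f : 'I_N -> R) : 'I_N -> R :=
  fun k => f (ordS k).

Definition shiftm (R : realType) (N : nat) (f : 'I_N -> R) : 'I_N -> R :=
  fun k => f (ord_pred k).

Definition discrete_laplacian (R : realType) (N : nat) (delta : R)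
    (f : 'I_N -> R) : 'I_N -> R :=
  fun k => (shiftp f k + shiftm f k - 2 * f k) / delta ^+ 2.

Definition positive_density (R : realType) (N : nat) (delta : R)
    (rho : 'I_N -> R) : Prop :=
  (forall k, 0 < rho k) /\ delta * (\sum_(k < N) rho k) = 1.

Definition discrete_entropy (R : realType) (N : nat) (delta : R)
    (rho : 'I_N -> R) : R :=
  delta * \sum_(k < N) (rho k * (ln (rho k) - 1) + 1).

(* [g] has derivative [l] at [t] relative to [J]: the usual two-sided
   derivative when [t] is interior to [J], the one-sided derivative when [t] is
   an endpoint of the interval [J]. *)
Definition has_derivative_within (R : realType) (J : set R) (g : R -> R)
    (t l : R) : Prop :=
  (g s - g t) / (s - t) @[s --> within J t^'] --> l.

Definition positive_solution (R : realType) (N : nat) (delta : R) (J : set R)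
    (rho : R -> 'I_N -> R) : Prop :=
  forall t, J t ->
    positive_density delta (rho t) /\
    forall k : 'I_N,
      has_derivative_within J (fun s => rho s k) t
        (- 2 * discrete_laplacian delta
                 (fun j => (Num.sqrt (shiftp (rho t) j * shiftm (rho t) j)
                            - rho t j) / delta ^+ 2) k).

Definition dissipation (R : realType) (N : nat) (delta : R)
    (rho : 'I_N -> R) : R :=
  4 * delta * \sum_(k < N)
    ((Num.sqrt (shiftp rho k * shiftm rho k) - rho k) / delta ^+ 2)
    * ((ln (Num.sqrt (shiftp rho k * shiftm rho k)) - ln (rho k))
       / delta ^+ 2).

(* Main.v *)
Require Import Defs.
From HB Require Import structures.
From mathcomp Require Import all_boot all_order all_algebra.
From mathcomp Require Import all_classical all_reals all_analysis.
From mathcomp Require Import ring lra.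
Import Order.TTheory GRing.Theory Num.Theory.
Import numFieldNormedType.Exports.
Local Open Scope classical_set_scope.
Local Open Scope ring_scope.

(** Along a solution the entropy density x (ln x - 1) + 1 has derivative ln x,
    so the entropy decreases at rate 2 delta times the sum of ln rho against
    the discrete Laplacian of g = (sqrt (rho_+ rho_-) - rho) / delta^2.  The
    Laplacian is symmetric ([discrete_laplacian_sym]); moving it onto ln rho
    turns it into twice the difference ln (sqrt (rho_+ rho_-)) - ln rho, over
    delta^2, and the sum becomes the dissipation ([entropy_variation]).

    The inequality is not true site by site: at a site where rho is the
    geometric mean of its neighbours the dissipation density vanishes, while
    the Laplacian of sqrt rho need not.  It becomes true site by site after
    adding a term that sums to zero over the cycle.  With v = rho^(1/4), the
    arguments of the two logarithms are (v_+ v_-)^2 and (v^2)^2, and the bound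
    of the logarithmic mean by the arithmetic mean gives
    [[
      ((v_+ v_-)^2 - v^4) (ln ((v_+ v_-)^2) - ln (v^4))
        >= 4 (v_+ v_- - v^2)^2
    ]]
    ([sqr_log_difference_ge]).  The dissipation carries another factor 4, so
    what remains, after division by delta^-4, is the polynomial inequality
    [[
      16 (v_+ v_- - v^2)^2
        + 4 ((v_+ - v)^3 (v_+ + v) + (v_- - v)^3 (v_- + v))
        >= (v_+^2 + v_-^2 - 2 v^2)^2
    ]]
    of [sqr_second_difference_le].  Its second term sums to zero because
    (y - x)^3 (y + x) is antisymmetric in x and y, so that each edge of the
    cycle is counted once with each sign ([sum_antisymmetric_neighbours]). *)

Lemma sum_ordS (V : nmodType) (N : nat) (f : 'I_N -> V) :
  \sum_(k < N) f (ordS k) = \sum_(k < N) f k.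
Proof. by rewrite [RHS](reindex (@ordS N))//; apply/onW_bij/ordS_bij. Qed.

(** Summation by parts on the cycle: shifting forward is adjoint to shifting
    backward, and the Laplacian contains both. *)
Lemma discrete_laplacian_sym (R : realType) (N : nat) (delta : R)
    (f g : 'I_N -> R) :
  \sum_(k < N) f k * discrete_laplacian delta g k =
  \sum_(k < N) g k * discrete_laplacian delta f k.
Proof.
have shift_sym (u v : 'I_N -> R) :
    \sum_k u k * v (ordS k) = \sum_k v k * u (ord_pred k).
  rewrite -[RHS]sum_ordS; apply: eq_bigr => k _.
  by rewrite ordSK mulrC.
have expand (u v : 'I_N -> R) : \sum_k u k * discrete_laplacian delta v k =
    (\sum_k u k * v (ordS k) + \sum_k u k * v (ord_pred k)
     - 2 * \sum_k u k * v k) / delta ^+ 2.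
  rewrite mulr_sumr -sumrN -!big_split mulr_suml/=; apply: eq_bigr => k _.
  by rewrite /discrete_laplacian /shiftp /shiftm; ring.
rewrite !expand shift_sym (shift_sym g f).
have -> : \sum_k f k * g k = \sum_k g k * f k.
  by apply: eq_bigr => k _; rewrite mulrC.
by congr ((_ - _) / _); rewrite addrC.
Qed.

(** The edge between k and k + 1 contributes [h (v k) (v (ordS k))] at one end
    and its opposite at the other.  For N = 1 and N = 2, where neighbours
    coincide, the edges are counted with multiplicity. *)
Lemma sum_antisymmetric_neighbours (R : realType) (N : nat) (h : R -> R -> R)
    (v : 'I_N -> R) (antisym : forall x y, h x y = - h y x) :
  \sum_(k < N) (h (v k) (v (ordS k)) + h (v k) (v (ord_pred k))) = 0.
Proof.
rewrite big_split/= -[X in _ + X]sum_ordS -big_split/= big1// => k _.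
by rewrite ordSK antisym addNr.
Qed.

(** The derivative of ln x - 2 (x - 1) / (x + 1) is (x - 1)^2 / (x (x + 1)^2),
    which is nonnegative, and the difference vanishes at 1. *)
Lemma ln_ge_pade (R : realType) (z : R) :
  1 <= z -> 2 * (z - 1) / (z + 1) <= ln z.
Proof.
move=> z1.
(* f - 2 is the difference, as 2 (x - 1) / (x + 1) = 2 - 4 / (x + 1). *)
pose f x : R := ln x + 4 * (x + 1)^-1.
have df (x : R) : 0 < x -> is_derive x 1 f ((x - 1) ^+ 2 / (x * (x + 1) ^+ 2)).
  move=> x0; have xn : x + 1 != 0 by rewrite gt_eqF// addr_gt0.
  have lnd := is_derive1_ln x0.
  have invd : is_derive x 1 (fun y : R => (y + 1)^-1) (- (x + 1) ^- 2 *: 1).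
    apply: (is_deriveV (f := fun y : R => y + 1)) => //.
    by apply: is_derive_eq; rewrite addr0.
  rewrite /f.
  apply: is_derive_eq; rewrite /GRing.scale/=.
  by field; rewrite xn gt_eqF.
have f_nd : f 1 <= f z.
  apply: (@ger0_derive1_ndecry _ f 1) => // [x|x|].
  - by rewrite in_itv/= andbT => x1; apply: ex_derive; apply: df; lra.
  - rewrite in_itv/= andbT => x1; have x0 : 0 < x by lra.
    rewrite derive1E (@derive_val _ _ _ _ _ _ _ (df _ x0)).
    by rewrite divr_ge0// ?sqr_ge0// mulr_ge0// ?sqr_ge0// ltW.
  - apply: continuous_in_subspaceT => x; rewrite inE/= in_itv/= andbT => x1.
    apply: differentiable_continuous; apply/derivable1_diffP.
    by apply: ex_derive; apply: df; lra.
have -> : 2 * (z - 1) / (z + 1) = 2 - 4 * (z + 1)^-1.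
  by field; rewrite gt_eqF//; lra.
have f1 : f 1 = 2 by rewrite /f ln1; field.
by move: f_nd; rewrite f1 /f; lra.
Qed.

(** The logarithmic mean (x - y) / (ln x - ln y) is at most the arithmetic mean
    (x + y) / 2.  The constant 4 is attained to leading order as x - y tends
    to 0. *)
Lemma sqr_log_difference_ge (R : realType) (x y : R) : 0 < x -> 0 < y ->
  4 * (x - y) ^+ 2 <= (x ^+ 2 - y ^+ 2) * (ln (x ^+ 2) - ln (y ^+ 2)).
Proof.
wlog yx : x y / y <= x => [H x0 y0|x0 y0].
  have [yx|/ltW xy] := leP y x; first exact: H.
  by have := H y x xy y0 x0; lra.
rewrite !lnXn//.
have pade : 2 * (x - y) / (x + y) <= ln x - ln y.
  rewrite -ln_div ?posrE//.
  have <- : 2 * (x / y - 1) / (x / y + 1) = 2 * (x - y) / (x + y).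
    by field; rewrite !gt_eqF// ?addr_gt0// divr_gt0.
  by apply: ln_ge_pade; rewrite ler_pdivlMr// mul1r.
have : 2 * ((x - y) * (x + y)) * (2 * (x - y) / (x + y)) <=
       2 * ((x - y) * (x + y)) * (ln x - ln y).
  by apply: ler_wpM2l => //; rewrite !mulr_ge0//; lra.
have -> : 2 * ((x - y) * (x + y)) * (2 * (x - y) / (x + y)) =
          4 * (x - y) ^+ 2.
  by field; rewrite gt_eqF// addr_gt0.
by congr (_ <= _); ring.
Qed.

(** Near a = b = c the difference of the two sides is small to second order in
    a + b - 2 c and (a - b)^2, which suggests the variables m = a + b and
    w = (a - b)^2 / 4.  In them it is the quadratic polynomial in w
    [[
      20 w^2 + 2 (m - 2 c) (m - 10 c) w
        + (m - 2 c)^2 (5 m^2 + 12 m c + 4 c^2) / 4,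
    ]]
    to be shown nonnegative for w >= 0.  For m <= 2 c all its coefficients are
    nonnegative; for m > 2 c its discriminant is negative.  The factor 4 of the
    antisymmetric terms makes this work: the same inequality with 2, the least
    value not excluded by a b = c^2, fails near a = b = c. *)
Lemma sqr_second_difference_le (R : realType) (a b c : R) :
  0 < a -> 0 < b -> 0 < c ->
  (a ^+ 2 + b ^+ 2 - 2 * c ^+ 2) ^+ 2
  - 4 * ((a - c) ^+ 3 * (a + c) + (b - c) ^+ 3 * (b + c))
  <= 16 * (a * b - c ^+ 2) ^+ 2.
Proof.
move=> a0 b0 c0; rewrite -subr_ge0.
pose m := a + b; pose w := (a - b) ^+ 2 / 4.
have w0 : 0 <= w by rewrite divr_ge0// sqr_ge0.
have m0 : 0 < m by rewrite addr_gt0.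
set E := (X in 0 <= X).
have EE : E = 20 * w ^+ 2 + 2 * ((m - 2 * c) * (m - 10 * c)) * w
    + (m - 2 * c) ^+ 2 * (5 * m ^+ 2 + 12 * (m * c) + 4 * c ^+ 2) / 4.
  by rewrite /E /w /m; field.
have mc0 : 0 < m * c by rewrite mulr_gt0.
have [m2|m2] := leP m (2 * c).
  have q0 : 0 <= (m - 2 * c) * (m - 10 * c) by apply: mulr_le0; lra.
  rewrite EE; apply: addr_ge0; first apply: addr_ge0.
  - by rewrite mulr_ge0// sqr_ge0.
  - by apply: mulr_ge0 => //; apply: mulr_ge0.
  - rewrite divr_ge0// mulr_ge0 ?sqr_ge0//.
    by have := sqr_ge0 m; have := sqr_ge0 c; lra.
(* Completion of the square in w. *)
have E20 : 20 * E = (20 * w + (m - 2 * c) * (m - 10 * c)) ^+ 2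
    + (m - 2 * c) ^+ 2 * (24 * m ^+ 2 + 80 * (c * (m - c))).
  by rewrite EE; field.
rewrite -(@pmulr_rge0 _ 20)// E20 addr_ge0 ?sqr_ge0//.
rewrite mulr_ge0 ?sqr_ge0// addr_ge0 ?mulr_ge0 ?sqr_ge0 ?ltW//.
by lra.
Qed.

Lemma ln_sqrtM (R : realType) (x y : R) : 0 < x -> 0 < y ->
  ln (Num.sqrt (x * y)) = (ln x + ln y) / 2.
Proof.
move=> x0 y0; have xy0 : 0 < x * y by rewrite mulr_gt0.
rewrite -lnM ?posrE// -[in RHS](@sqr_sqrtr _ (x * y)) ?ltW//.
by rewrite lnXn ?sqrtr_gt0//; field.
Qed.

(** The site-by-site comparison in terms of v = rho^(1/4), after a multiple of
    the vanishing antisymmetric sum is subtracted from the left-hand side. *)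
Lemma dissipation_ge (R : realType) (N : nat) (delta : R) (rho : 'I_N -> R) :
  0 < delta -> (forall k, 0 < rho k) ->
  delta * \sum_(k < N)
    (discrete_laplacian delta (fun j => Num.sqrt (rho j)) k) ^+ 2
  <= dissipation delta rho.
Proof.
move=> delta0 rho0.
pose v k := Num.sqrt (Num.sqrt (rho k)).
have v0 k : 0 < v k by rewrite !sqrtr_gt0.
have sqrt_rho k : Num.sqrt (rho k) = v k ^+ 2 by rewrite sqr_sqrtr// sqrtr_ge0.
have rhoE k : rho k = (v k ^+ 2) ^+ 2 by rewrite -sqrt_rho sqr_sqrtr// ltW.
have sqrt_rhoM j k : Num.sqrt (rho j * rho k) = (v j * v k) ^+ 2.
  by rewrite sqrtrM ?(ltW (rho0 _))// !sqrt_rho exprMn.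
pose h x y : R := (y - x) ^+ 3 * (y + x).
have null : \sum_(k < N) (h (v k) (v (ordS k)) + h (v k) (v (ord_pred k))) = 0.
  by apply: sum_antisymmetric_neighbours => x y; rewrite /h; ring.
rewrite /dissipation [4 * delta]mulrC -mulrA ler_pM2l//.
rewrite -[leLHS]subr0 -[X in _ - X](mulr0 (4 / delta ^+ 4)).
rewrite -[X in _ - _ * X]null !mulr_sumr -sumrB.
apply: ler_sum => k _.
rewrite /discrete_laplacian /shiftp /shiftm sqrt_rhoM !sqrt_rho (rhoE k).
set a := v (ordS k); set b := v (ord_pred k); set c := v k.
have dn : delta != 0 by rewrite gt_eqF.
have := @sqr_second_difference_le _ a b c (v0 _) (v0 _) (v0 _).
have := @sqr_log_difference_ge _ (a * b) (c ^+ 2)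
  (mulr_gt0 (v0 _) (v0 _)) (exprn_gt0 _ (v0 _)).
set L := ln _ - ln _ => logle polyle.
have d4 : 0 < delta ^- 4 by rewrite invr_gt0 exprn_gt0.
have -> : 4 * (((a * b) ^+ 2 - (c ^+ 2) ^+ 2) / delta ^+ 2 * (L / delta ^+ 2))
    = delta ^- 4 * (4 * (((a * b) ^+ 2 - (c ^+ 2) ^+ 2) * L)).
  by field.
have -> : ((a ^+ 2 + b ^+ 2 - 2 * c ^+ 2) / delta ^+ 2) ^+ 2
          - 4 / delta ^+ 4 * (h c a + h c b) =
    delta ^- 4 * ((a ^+ 2 + b ^+ 2 - 2 * c ^+ 2) ^+ 2
  - 4 * ((a - c) ^+ 3 * (a + c) + (b - c) ^+ 3 * (b + c))).
  by rewrite /h; field.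
by rewrite ler_pM2l//; lra.
Qed.

Lemma entropy_variation (R : realType) (N : nat) (delta : R)
    (rho : 'I_N -> R) : (forall k, 0 < rho k) ->
  delta * \sum_(k < N) ln (rho k) *
    (- 2 * discrete_laplacian delta
       (fun j => (Num.sqrt (shiftp rho j * shiftm rho j) - rho j)
                 / delta ^+ 2) k)
  = - dissipation delta rho.
Proof.
move=> rho0; rewrite /dissipation.
rewrite (eq_bigr (fun k => - 2 * (ln (rho k) * discrete_laplacian delta
       (fun j => (Num.sqrt (shiftp rho j * shiftm rho j) - rho j)
                 / delta ^+ 2) k))) => [|k _]; last by ring.
rewrite -mulr_sumr (discrete_laplacian_sym _ _ delta (fun k => ln (rho k))).
rewrite mulrCA !mulr_sumr -sumrN; apply: eq_bigr => k _.
rewrite ln_sqrtM ?rho0// /discrete_laplacian /shiftp /shiftm.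
by move: (delta ^+ 2)^-1 => d; field.
Qed.

Lemma has_derivative_within_continuous (R : realType) (J : set R) (g : R -> R)
    (t l : R) :
  has_derivative_within J g t l -> g s @[s --> within J t^'] --> g t.
Proof.
move=> dg.
have st : s - t @[s --> within J t^'] --> (0 : R).
  rewrite -(subrr t); apply: cvgB; last exact: cvg_cst.
  by move=> A /nbhs_dnbhs; apply: filterS => x Ax _.
have lim : (g s - g t) / (s - t) * (s - t) + g t @[s --> within J t^'] --> g t.
  rewrite -[X in _ --> X]add0r -(mulr0 l).
  by apply: cvgD; [exact: cvgM|exact: cvg_cst].
apply: cvg_trans lim; apply: near_eq_cvg.
near=> s.
rewrite divfK ?subrK// subr_eq0.
near: s; apply: cvg_within; exact: withinT.
Unshelve. all: by end_near. Qed.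

(** The inner increment [g s - g t] may vanish for s arbitrarily close to t;
    Caratheodory's form of differentiability avoids dividing by it. *)
Lemma has_derivative_within_comp (R : realType) (J : set R) (f g : R -> R)
    (t l a : R) :
  is_derive (g t) 1 f a -> has_derivative_within J g t l ->
  has_derivative_within J (fun s => f (g s)) t (a * l).
Proof.
move=> /is_derive1_caratheodory[q [fE qc <-]] dg.
have qg : q (g s) @[s --> within J t^'] --> q (g t).
  exact: continuous_cvg qc (has_derivative_within_continuous _ _ _ _ _ dg).
rewrite /has_derivative_within.
have -> : (fun s => (f (g s) - f (g t)) / (s - t)) =
          (fun s => q (g s) * ((g s - g t) / (s - t))).
  by apply/funext => s; rewrite fE mulrA.
exact: cvgM.
Qed.

Lemma has_derivative_within_scaled_sum (R : realType) (J : set R) (I : finType)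
    (c : R) (F : I -> R -> R) (t : R) (l : I -> R) :
  (forall i, has_derivative_within J (F i) t (l i)) ->
  has_derivative_within J (fun s => c * \sum_i F i s) t (c * \sum_i l i).
Proof.
move=> dF; rewrite /has_derivative_within.
have -> : (fun s => (c * \sum_i F i s - c * \sum_i F i t) / (s - t)) =
          (fun s => c * \sum_i (F i s - F i t) / (s - t)).
  by apply/funext => s; rewrite -mulrBr -sumrB -mulrA mulr_suml.
apply: cvgM; first exact: cvg_cst.
apply: cvg_big => [|i _]; last exact: dF.
exact: pseudometric_normed_Zmodule.add_continuous.
Qed.

Lemma is_derive_entropy_density (R : realType) (x : R) : 0 < x ->
  is_derive x 1 (fun y : R => y * (ln y - 1) + 1) (ln x).
Proof.
move=> x0; have lnd := is_derive1_ln x0.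
apply: is_derive_eq; rewrite /GRing.scale/=.
by field; rewrite gt_eqF.
Qed.

Theorem lemma18 (R : realType) (N : nat) (hN : (0 < N)%N)
    (delta : R) (hdelta : delta = 1 / N%:R)
    (J : set R) (hJ : is_interval J)
    (hJnd : exists a b : R, [/\ J a, J b & a < b])
    (rho : R -> 'I_N -> R) (hrho : positive_solution delta J rho)
    (t : R) (ht : J t) :
  has_derivative_within J (fun s => discrete_entropy delta (rho s)) t
    (- dissipation delta (rho t)) /\
  dissipation delta (rho t) >=
    delta * \sum_(k < N)
      (discrete_laplacian delta (fun j => Num.sqrt (rho t j)) k) ^+ 2.
Proof.
have [[rho_gt0 _] drho] := hrho t ht.
have delta_gt0 : 0 < delta by rewrite hdelta divr_gt0// ltr0n.
split; last exact: dissipation_ge.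
rewrite -entropy_variation//.
apply: has_derivative_within_scaled_sum => k.
apply: (has_derivative_within_comp _ _ (fun y => y * (ln y - 1) + 1)).
  exact: is_derive_entropy_density.
exact: drho.
Qed.
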